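(* Let $p>n\ge 1$ be integers, let $\beta\in\mathbb{R}^p$, and let $y=X\beta+\varepsilon$, where $X\in\mathbb{R}^{n\times p}$ is a random matrix, $\varepsilon\in\mathbb{R}^n$ is a random vector independent of $X$ with $\mathbb{E}[\varepsilon]=0$, and $\Omega:=\mathbb{E}[\varepsilon\varepsilon^\top]$ is finite and positive definite. Assume that $X$ is left-spherical. Let $\Sigma\in\mathbb{R}^{p\times p}$ be the (finite, positive definite) matrix $\Sigma=\mathbb{E}[x_0x_0^\top]$ of a test feature vector $x_0\in\mathbb{R}^p$ independent of the training data, and let $\hat\beta=X^\dagger y$. Then $$\mathbb{E}_X\big[\mathrm{Var}_\Sigma(\hat\beta\mid X)\big]=\frac1n\,\mathrm{Tr}(\Omega)\,\mathbb{E}_X\big[\mathrm{Tr}\big((X^\top X)^\dagger\Sigma\big)\big].$$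
   Context: $A^\dagger$ denotes the Moore–Penrose inverse of a matrix $A$. The ridgeless (minimum $\ell_2$ norm) least squares estimator is $\hat\beta:=\arg\min_{b\in\mathbb{R}^p}\{\|b\|:Xb=y\}=(X^\top X)^\dagger X^\top y=X^\dagger y$. For a square matrix $A$, $\mathrm{Var}_A(\hat\beta\mid X):=\mathrm{Tr}(\mathrm{Cov}(\hat\beta\mid X)A)$, where $\mathrm{Cov}(\hat\beta\mid X)$ is the conditional covariance matrix given $X$. A random matrix $Z$ with $n$ rows is called left-spherical if $OZ$ and $Z$ have the same distribution for every fixed orthogonal matrix $O\in O(n)=\{A\in\mathbb{R}^{n\times n}:AA^\top=A^\top A=I\}$. $\mathbb{E}_X$ denotes expectation over $X$. *)

(* Defs.v *)
From HB Require Import structures.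
From mathcomp Require Import all_boot all_order all_algebra.
From mathcomp Require Import all_classical all_reals all_analysis measurable_realfun.

Set Implicit Arguments.
Unset Strict Implicit.
Unset Printing Implicit Defensive.

Import Order.TTheory GRing.Theory Num.Theory.
Import numFieldNormedType.Exports.

Local Open Scope classical_set_scope.
Local Open Scope ring_scope.

(** Real matrices carry the Borel sigma-algebra of their product topology, so
    that [{RV P >-> 'M[R]_(m, n)}] is the type of random matrices. *)
Definition mx_open (R : realType) (m n : nat) : set (set 'M[R]_(m, n)) :=
  [set A | open A].

HB.instance Definition _ (R : realType) (m n : nat) :=
  @isMeasurable.Build (sigma_display (@mx_open R m n)) 'M[R]_(m, n)
    <<s @mx_open R m n >> (@sigma_algebra0 _ setT _) (@sigma_algebraC _ _)
    (@sigma_algebra_bigcup _ setT _).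

Section Matrices.
Variable R : realType.

Definition posdefmx (n : nat) (A : 'M[R]_n) : Prop :=
  A^T = A /\ forall v : 'cV[R]_n, v != 0 -> 0 < (v^T *m A *m v) 0 0.

Definition is_mpinv (m n : nat) (A : 'M[R]_(m, n)) (B : 'M[R]_(n, m)) : Prop :=
  [/\ A *m B *m A = A, B *m A *m B = B,
      (A *m B)^T = A *m B & (B *m A)^T = B *m A].

(** The Moore-Penrose inverse: the four Penrose equations have exactly one
    solution, so the default value [0] is never selected. *)
Definition mpinv (m n : nat) (A : 'M[R]_(m, n)) : 'M[R]_(n, m) :=
  xget 0 [set B | is_mpinv A B].

End Matrices.

Section Probability.
Context d (T : measurableType d) (R : realType) (P : probability T R).

Definition mx_integrable (m n : nat) (Z : T -> 'M[R]_(m, n)) : Prop :=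
  forall i j, P.-integrable [set: T] (fun w => (Z w i j)%:E).

(** Entrywise expectation, meaningful when [mx_integrable Z]. *)
Definition mx_expectation (m n : nat) (Z : T -> 'M[R]_(m, n)) : 'M[R]_(m, n) :=
  \matrix_(i, j) fine 'E_P[fun w => Z w i j].

Definition indep_RV d1 d2 (U : measurableType d1) (V : measurableType d2)
    (X : T -> U) (Y : T -> V) : Prop :=
  forall (A : set U) (B : set V), measurable A -> measurable B ->
    P (X @^-1` A `&` Y @^-1` B) = (P (X @^-1` A) * P (Y @^-1` B))%E.

Definition left_spherical (n p : nat) (Z : T -> 'M[R]_(n, p)) : Prop :=
  forall O : 'M[R]_n, O *m O^T = 1%:M -> O^T *m O = 1%:M ->
  forall B : set 'M[R]_(n, p), measurable B ->
    pushforward P (fun w => O *m Z w) B = pushforward P Z B.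

Section Conditional.
Context d' (U : measurableType d') (X : T -> U).

(** [Z] is a version of E[Y | X] for a nonnegative [Y]; the value +oo is
    allowed, so no integrability of [Y] is required. *)
Definition is_cexp_ge0 (Y Z : T -> \bar R) : Prop :=
  [/\ forall w, (0 <= Z w)%E,
      measurable_fun setT (Z : g_sigma_algebra_preimageType X -> \bar R) &
      forall A : set T, g_sigma_algebra_preimage X A ->
        (\int[P]_(w in A) Z w = \int[P]_(w in A) Y w)%E].

(** A version always exists for measurable [Y >= 0] (Radon-Nikodym) and is
    almost surely unique. *)
Definition cexp_ge0 (Y : T -> \bar R) : T -> \bar R :=
  xget (cst 0%E) [set Z | is_cexp_ge0 Y Z].

(** E[Y | X] is the difference of the conditional expectations of the positive
    and negative parts of [Y], as soon as almost surely one of them is finite.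
    E|Y| < +oo is not required: the least squares estimator need not be
    integrable, although its conditional moments given the design exist. *)
Definition cexp (Y : T -> \bar R) : T -> \bar R :=
  (cexp_ge0 (Y ^\+)%E \- cexp_ge0 (Y ^\-)%E)%E.

Definition mx_cexp (m n : nat) (Z : T -> 'M[R]_(m, n)) (w : T) : 'M[R]_(m, n) :=
  \matrix_(i, j) fine (cexp (fun w' => (Z w' i j)%:E) w).

Definition ccov (p : nat) (Y : T -> 'cV[R]_p) : T -> 'M[R]_p :=
  mx_cexp (fun w => (Y w - mx_cexp Y w) *m (Y w - mx_cexp Y w)^T).

Definition cvar (p : nat) (A : 'M[R]_p) (Y : T -> 'cV[R]_p) (w : T) : R :=
  \tr (ccov Y w *m A).

End Conditional.

End Probability.

(* Main.v *)
Require Import Defs.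
From HB Require Import structures.
From mathcomp Require Import all_boot all_order all_algebra ring lra.
From mathcomp Require Import fingroup perm.
From mathcomp Require Import all_classical all_reals all_analysis measurable_realfun.

(** Write [A^+] for the Moore-Penrose inverse. Since [eps] is centred and
    independent of [X], almost surely [E[betahat | X] = X^+ X beta] and
    [Cov(betahat | X) = X^+ Omega X^+^T], so the left-hand side is
    [E tr(Omega Q(X))] with [Q(X) = X^+^T Sigma X^+] positive semidefinite.
    For orthogonal [O], [(O X)^+ = X^+ O^T], hence [Q(O X) = O Q(X) O^T] and
    sphericity allows averaging over [O]. Averaging over all diagonal sign
    matrices leaves [sum_i Omega_ii E Q(X)_ii], and transpositions show that
    [E Q(X)_ii] does not depend on [i]; it is thus [E tr Q(X) / n], and
    [tr Q(X) = tr((X^T X)^+ Sigma)]. All integrands are nonnegative, so the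
    computation remains valid when [E tr Q(X)] is infinite. *)

Set Implicit Arguments.
Unset Strict Implicit.
Unset Printing Implicit Defensive.

Import Order.TTheory GRing.Theory Num.Theory.
Import numFieldNormedType.Exports.

Local Open Scope classical_set_scope.
Local Open Scope ring_scope.

(** * The Moore-Penrose inverse: existence, uniqueness, ridge approximation *)

Section MoorePenrose.
Variable R : realType.

Lemma mulmx_tr_ge0 n (v : 'rV[R]_n) : 0 <= (v *m v^T) 0 0.
Proof. by rewrite mxE sumr_ge0// => i _; rewrite mxE -expr2 sqr_ge0. Qed.

Lemma mulmx_tr_eq0 n (v : 'rV[R]_n) : (v *m v^T) 0 0 = 0 -> v = 0.
Proof.
rewrite mxE => /eqP; rewrite psumr_eq0; last first.
  by move=> i _; rewrite mxE -expr2 sqr_ge0.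
move=> /allP v0; apply/rowP => i; have /= := v0 i (mem_index_enum _).
by rewrite !mxE -expr2 sqrf_eq0 => /eqP.
Qed.

(** If [v A A^T = 0], then [v A] has squared norm zero, and full row rank gives [v = 0]. *)
Lemma unitmx_mul_tr m n (A : 'M[R]_(m, n)) :
  row_free A -> A *m A^T \in unitmx.
Proof.
move=> fA; rewrite -row_free_unit -kermx_eq0; apply/eqP/row_matrixP => i.
set v := row i _; rewrite row0.
have : v *m (A *m A^T) = 0 by rewrite -row_mul mulmx_ker row0.
move=> vAA; apply: (row_free_inj fA); rewrite mul0mx; apply: mulmx_tr_eq0.
by rewrite trmx_mul !mulmxA -(mulmxA v) vAA mul0mx mxE.
Qed.

(** [A B = (A C)(A B)], and transposing this product of symmetric matrices gives [(A B)(A C) = A C].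
    Likewise [B A = C A], hence [B = B A B = C A C = C]. *)
Lemma is_mpinv_uniq m n (A : 'M[R]_(m, n)) B C :
  is_mpinv A B -> is_mpinv A C -> B = C.
Proof.
move=> [b1 b2 b3 b4] [c1 c2 c3 c4].
have AB : A *m B = A *m C.
  have e : A *m B = (A *m C) *m (A *m B) by rewrite !mulmxA c1.
  by rewrite -[LHS]b3 e trmx_mul b3 c3 !mulmxA b1.
have BA : B *m A = C *m A.
  have e : B *m A = (B *m A) *m (C *m A) by rewrite -!mulmxA (mulmxA A C) c1.
  by rewrite -[LHS]b4 e trmx_mul b4 c4 -!mulmxA (mulmxA A B) b1.
by rewrite -b2 BA -mulmxA AB mulmxA c2.
Qed.

(** From a rank factorization [A = C D], both Gram matrices [D D^T] and [C^T C] are invertible, and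
    [D^T (D D^T)^-1 (C^T C)^-1 C^T] solves the Penrose equations. *)
Lemma is_mpinv_ex m n (A : 'M[R]_(m, n)) : exists B, is_mpinv A B.
Proof.
have [r [C [D [rC rD ->]]]] : exists r (C : 'M[R]_(m, r)) (D : 'M[R]_(r, n)),
    [/\ row_full C, row_free D & A = C *m D].
  exists (\rank A), (col_base A), (row_base A).
  by rewrite col_base_full row_base_free mulmx_base.
have fD : D *m D^T \in unitmx by apply/unitmx_mul_tr.
have fC : C^T *m C \in unitmx.
  rewrite -{2}[C]trmxK; apply/unitmx_mul_tr.
  by rewrite /row_free mxrank_tr.
pose G := invmx (D *m D^T); pose H := invmx (C^T *m C).
have GT : G^T = G by rewrite /G trmx_inv trmx_mul trmxK.
have HT : H^T = H by rewrite /H trmx_inv trmx_mul trmxK.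
pose B := D^T *m G *m H *m C^T.
have AB : (C *m D) *m B = C *m H *m C^T.
  by rewrite /B !mulmxA -(mulmxA C) -(mulmxA C) mulmxV// mulmx1.
have BA : B *m (C *m D) = D^T *m G *m D.
  by rewrite /B !mulmxA -(mulmxA _ C^T) -(mulmxA (D^T *m G)) mulVmx// mulmx1.
exists B; split.
- rewrite AB !mulmxA -(mulmxA _ C^T) -(mulmxA C) mulVmx// mulmx1//.
- rewrite BA /B !mulmxA -(mulmxA (D^T *m G) D) -(mulmxA D^T G) mulVmx// mulmx1//.
- by rewrite AB !trmx_mul trmxK HT mulmxA.
- by rewrite BA !trmx_mul trmxK GT mulmxA.
Qed.

Lemma mpinvP m n (A : 'M[R]_(m, n)) : is_mpinv A (mpinv A).
Proof. exact: (xgetPex 0 (is_mpinv_ex A)). Qed.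

Lemma mpinvE m n (A : 'M[R]_(m, n)) B : is_mpinv A B -> mpinv A = B.
Proof. exact/is_mpinv_uniq/mpinvP. Qed.

(** Both products of [A^T A] with [B B^T] collapse to the symmetric projection [B A]. *)
Lemma mpinv_gram m n (A : 'M[R]_(m, n)) :
  mpinv (A^T *m A) = mpinv A *m (mpinv A)^T.
Proof.
have [a1 a2 a3 a4] := mpinvP A; set B := mpinv A in a1 a2 a3 a4 *.
have b1 : B^T *m A^T *m A = A by rewrite -trmx_mul a3.
have b2 : A^T *m A *m B = A^T by rewrite -mulmxA -[in A *m B]a3 -trmx_mul a1.
have e1 : A^T *m A *m (B *m B^T) = B *m A by rewrite mulmxA b2 -trmx_mul a4.
have e2 : B *m B^T *m (A^T *m A) = B *m A by rewrite -mulmxA (mulmxA B^T) b1.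
apply: mpinvE; split.
- by rewrite e1 -a4 mulmxA -trmx_mul mulmxA a1.
- by rewrite e2 mulmxA a2.
- by rewrite e1.
- by rewrite e2.
Qed.

Lemma mpinv_orthogonal m n (O : 'M[R]_m) (A : 'M[R]_(m, n)) :
  O^T *m O = 1%:M -> mpinv (O *m A) = mpinv A *m O^T.
Proof.
move=> OO; have [a1 a2 a3 a4] := mpinvP A; set B := mpinv A in a1 a2 a3 a4 *.
have e1 : O *m A *m (B *m O^T) = O *m (A *m B) *m O^T by rewrite !mulmxA.
have e2 : B *m O^T *m (O *m A) = B *m A.
  by rewrite mulmxA -(mulmxA B) OO mulmx1.
apply: mpinvE; split.
- by rewrite -mulmxA e2 -mulmxA (mulmxA A) a1.
- by rewrite e2 mulmxA a2.
- by rewrite e1 !trmx_mul trmxK -trmx_mul a3 mulmxA.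
- by rewrite e2.
Qed.

(** Expanding [|w - u|^2 >= 0] bounds [2 w.u] by [|w|^2 + |u|^2]; this replaces Cauchy-Schwarz. *)
Lemma dotmx_le_sqr n (w u : 'cV[R]_n) : (w^T *m w) 0 0 <= (w^T *m u) 0 0 ->
  (w^T *m w) 0 0 <= (u^T *m u) 0 0.
Proof.
have : 0 <= ((w - u)^T *m (w - u)) 0 0.
  by have := mulmx_tr_ge0 (w - u)^T; rewrite trmxK.
have : (u^T *m w) 0 0 = (w^T *m u) 0 0.
  by rewrite -[u in RHS]trmxK -trmx_mul [RHS]mxE.
rewrite [(w - u)^T]linearB/= mulmxBl !mulmxBr.
set a := w^T *m w; set b := w^T *m u; set c := u^T *m w; set e := u^T *m u.
by clearbody a b c e => cb; rewrite !mxE; lra.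
Qed.

Section ridge.
Variables (m n : nat) (A : 'M[R]_(m, n)) (t : R).
Hypothesis t_gt0 : 0 < t.

Let G := A^T *m A + t%:M.

(** Pairing [v G = 0] with [v] gives [|v A^T|^2 + t |v|^2 = 0], which forces [v = 0]. *)
Lemma ridge_unitmx : G \in unitmx.
Proof.
rewrite -row_free_unit -kermx_eq0; apply/eqP/row_matrixP => i.
set v := row i _; rewrite row0.
have vG : v *m G = 0 by rewrite -row_mul mulmx_ker row0.
have : (v *m A^T *m (v *m A^T)^T) 0 0 + t * (v *m v^T) 0 0 = 0.
  have := congr1 (fun M => (M *m v^T) 0 0) vG.
  rewrite mul0mx [RHS]mxE => <-.
  by rewrite /G mulmxDr mulmxDl mul_mx_scalar -scalemxAl trmx_mul trmxK !mulmxA !mxE.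
move=> e; apply: mulmx_tr_eq0; apply/eqP.
have := mulmx_tr_ge0 (v *m A^T); have := mulmx_tr_ge0 v.
rewrite le_eqVlt => /predU1P[->//|v0] vA.
by move: e => /eqP; rewrite gt_eqF// ltr_wpDl// mulr_gt0.
Qed.

(** Pairing [G w = t u] with [w] gives [|A w|^2 + t |w|^2 = t w.u], so [|w|^2 <= w.u]. The bound is
    uniform in [t]. *)
Lemma ridge_contraction (u : 'cV[R]_n) (w := t *: (invmx G *m u)) :
  (w^T *m w) 0 0 <= (u^T *m u) 0 0.
Proof.
have Gw : G *m w = t *: u by rewrite -scalemxAr mulKVmx// ridge_unitmx.
have wGw : (w^T *m G *m w) 0 0 = ((A *m w)^T *m (A *m w)) 0 0 + t * (w^T *m w) 0 0.
  by rewrite /G mulmxDr mulmxDl mul_mx_scalar -scalemxAl trmx_mul !mulmxA !mxE.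
have wu : (w^T *m G *m w) 0 0 = t * (w^T *m u) 0 0.
  by rewrite -mulmxA Gw -scalemxAr mxE.
have tw : (w^T *m w) 0 0 <= (w^T *m u) 0 0.
  rewrite -(ler_pM2l t_gt0) -wu wGw lerDr.
  by have := mulmx_tr_ge0 (A *m w)^T; rewrite trmxK.
exact: dotmx_le_sqr.
Qed.

(* [A^T A N = B], so that [(A^T A + t)^-1 A^T = B - t (A^T A + t)^-1 B] can be
   expanded once more: the error is [t] times a bounded matrix. *)
Lemma ridge_mpinvB (B := mpinv A) (N := B *m B^T *m B) :
  B - invmx G *m A^T = t *: (N - t *: (invmx G *m N)).
Proof.
have [a1 a2 a3 a4] := mpinvP A; rewrite -/B in a1 a2 a3 a4.
have GB : A^T *m A *m B = A^T by rewrite -mulmxA -[in A *m B]a3 -trmx_mul a1.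
have GN : A^T *m A *m N = B by rewrite /N !mulmxA GB -trmx_mul a4 a2.
have e : G *m (B - invmx G *m A^T) = t *: B.
  by rewrite mulmxBr mulKVmx ?ridge_unitmx// /G mulmxDl GB mul_scalar_mx addrC addKr.
apply: (can_inj (mulKmx ridge_unitmx)); rewrite e -scalemxAr; congr (_ *: _).
rewrite mulmxBr -scalemxAr mulKVmx ?ridge_unitmx//.
by rewrite /G mulmxDl GN mul_scalar_mx addrK.
Qed.

End ridge.

(** By [ridge_mpinvB] and [ridge_contraction], the entrywise error is at most [t] times a constant
    independent of [t], here with [t = 1/(k+1)]. *)
Lemma mpinv_ridge_cvg m n (A : 'M[R]_(m, n)) i j :
  (invmx (A^T *m A + k.+1%:R^-1%:M) *m A^T) i j @[k --> \oo] --> mpinv A i j.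
Proof.
set B := mpinv A; pose N := B *m B^T *m B; pose u := col j N.
(* The summand [1 + |u|^2] dominates an entry of the contracted vector through [x <= 1 + x^2], with
   no square root; it also makes [C] positive. *)
pose C := `|N i j| + (1 + (u^T *m u) 0 0).
have C_ge k : `|B i j - (invmx (A^T *m A + k.+1%:R^-1%:M) *m A^T) i j|
    <= k.+1%:R^-1 * C.
  set t : R := k.+1%:R^-1; have t0 : 0 < t by rewrite invr_gt0.
  set S := invmx _ *m _.
  have -> : B i j - S i j = (t *: (N - t *: (invmx (A^T *m A + t%:M) *m N))) i j.
    by rewrite -ridge_mpinvB// [RHS]mxE [X in _ = _ + X]mxE.
  rewrite mxE normrM gtr0_norm// ler_pM2l// mxE (le_trans (ler_normD _ _))// lerD2l.
  have := ridge_contraction A t0 u; set w := t *: _ => wu.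
  have -> : (- (t *: (invmx (A^T *m A + t%:M) *m N))) i j = - w i 0.
    rewrite /w [LHS]mxE 2![in LHS]mxE [in RHS]mxE [in RHS]mxE.
    by congr (- (_ * _)); apply: eq_bigr => k' _; rewrite [u k' 0]mxE.
  have {}wu : w i 0 ^+ 2 <= (u^T *m u) 0 0.
    apply: le_trans wu; rewrite [leRHS]mxE (bigD1 i)//= [w^T _ _]mxE -expr2 lerDl sumr_ge0// => l _.
    by rewrite mxE -expr2 sqr_ge0.
  rewrite normrN; apply: le_trans (_ : 1 + `|w i 0| ^+ 2 <= _).
    have le_sqr (x : R) : x <= 1 + x ^+ 2 by have := sqr_ge0 (x - 1); nra.
    exact: le_sqr.
  by rewrite lerD2l real_normK// num_real.
have C0 : 0 < C.
  rewrite ltr_wpDl// ltr_pwDl//.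
  by have := mulmx_tr_ge0 u^T; rewrite trmxK.
apply/cvgrPdist_le => /= e e0; near=> k.
rewrite (le_trans (C_ge k))//.
rewrite -ler_pdivlMr//; apply/ltW; near: k.
by apply: near_infty_natSinv_lt (PosNum (divr_gt0 e0 C0)).
Unshelve. all: by end_near. Qed.

End MoorePenrose.

(** * Borel measurability of matrix operations, up to the pseudoinverse *)

Section MatrixMeasurability.
Variable R : realType.

Lemma mx_open_measurable m n (A : set 'M[R]_(m, n)) : open A -> measurable A.
Proof. exact: sub_gen_smallest. Qed.

Lemma mx_continuous_measurable m n p q (f : 'M[R]_(m, n) -> 'M[R]_(p, q)) :
  continuous f -> measurable_fun setT f.
Proof.
move=> /continuousP cf; apply: (measurability (@mx_open R p q)) => // _ [A oA <-].
by rewrite setTI; apply: mx_open_measurable; exact: cf.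
Qed.

Lemma measurable_coord m n i j :
  measurable_fun setT (fun M : 'M[R]_(m, n) => M i j).
Proof.
apply: (measurability _ (@RGenOpens.measurableE R)) => _ [_ [a [b ->]] <-].
rewrite setTI; apply: mx_open_measurable.
have /continuousP := @coord_continuous R m n i j; apply.
exact: interval_open.
Qed.

Lemma mulmx_continuous m n p (O : 'M[R]_(p, m)) :
  continuous (fun M : 'M[R]_(m, n) => O *m M).
Proof.
(* A neighbourhood of a matrix contains a finite product [Q] of entrywise neighbourhoods, so each
   entry can be treated separately. *)
move=> M /= B [Q MQ QB].
have cO i j : (fun M : 'M[R]_(m, n) => (O *m M) i j) N @[N --> M] --> (O *m M) i j.
  under eq_fun do rewrite mxE.
  rewrite mxE; apply: cvg_big; [exact: add_continuous|exact: nbhs_filter|move=> k _].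
  have ck : (fun N : 'M[R]_(m, n) => N k j) N @[N --> M] --> M k j.
    exact: coord_continuous.
  exact: (cvgMl_tmp (FF := nbhs_filter M) ck).
suff : \forall N \near M, forall i j, Q i j ((O *m N) i j).
  by apply: filterS => N NQ; apply: QB.
have FM := @nbhs_filter _ M.
apply: (@filter_forall _ _ _ (nbhs M)) => k; apply: (@filter_forall _ _ _ (nbhs M)) => l.
exact/cO/MQ.
Qed.

Section measurable_ops.
Context d (T : measurableType d).

Lemma measurable_mulmx m n p (f : T -> 'M[R]_(m, n)) (g : T -> 'M[R]_(n, p)) :
  (forall i j, measurable_fun setT (fun x => f x i j)) ->
  (forall i j, measurable_fun setT (fun x => g x i j)) ->
  forall i j, measurable_fun setT (fun x => (f x *m g x) i j).
Proof.
move=> mf mg i j; under eq_fun do rewrite mxE.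
by apply: measurable_sum => k; apply: measurable_funM.
Qed.

Lemma measurable_det n (f : T -> 'M[R]_n) :
  (forall i j, measurable_fun setT (fun x => f x i j)) ->
  measurable_fun setT (fun x => \det (f x)).
Proof.
move=> mf; apply: measurable_sum => s; apply: measurable_funM => //.
by apply: measurable_prod => i _.
Qed.

Lemma measurable_invr (f : T -> R) : measurable_fun setT f ->
  measurable_fun setT (fun x => (f x)^-1).
Proof.
move=> mf.
(* [x `^ (-1) = x^-1] only for [0 <= x], hence the detour through squares. *)
have -> : (fun x => (f x)^-1) = (fun x => f x * (f x ^+ 2) `^ (-1)).
  apply/funext => x; rewrite powR_inv1 ?sqr_ge0//.
  have [->|fx0] := eqVneq (f x) 0; first by rewrite mul0r invr0.
  by rewrite expr2 invfM mulVKf.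
apply: measurable_funM => //.
have mp : measurable_fun setT (fun x : R => x `^ (-1)) := measurable_powR (-1).
exact: (measurableT_comp mp (measurable_funX 2 mf)).
Qed.

(** The inverse is the adjugate over the determinant, and cofactors are again determinants. *)
Lemma measurable_invmx n (f : T -> 'M[R]_n) : (forall x, f x \in unitmx) ->
  (forall i j, measurable_fun setT (fun x => f x i j)) ->
  forall i j, measurable_fun setT (fun x => invmx (f x) i j).
Proof.
move=> uf mf i j.
under eq_fun do rewrite /invmx uf 2!mxE.
apply: measurable_funM; first exact/measurable_invr/measurable_det.
apply: measurable_funM => //; apply: measurable_det => k l.
by under eq_fun do rewrite !mxE; exact: mf.
Qed.

(** The pseudoinverse is discontinuous where the rank drops, but it is a pointwise limit of the
    measurable ridge inverses. *)
Lemma measurable_mpinv m n (f : T -> 'M[R]_(m, n)) :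
  (forall i j, measurable_fun setT (fun x => f x i j)) ->
  forall i j, measurable_fun setT (fun x => mpinv (f x) i j).
Proof.
move=> mf i j.
have mfT k l : measurable_fun setT (fun x => (f x)^T k l).
  by under eq_fun do rewrite mxE; exact: mf.
apply: (measurable_fun_cvg (h := fun k x =>
    (invmx ((f x)^T *m f x + k.+1%:R^-1%:M) *m (f x)^T) i j)); last first.
  by move=> x _; exact: mpinv_ridge_cvg.
move=> k; apply: measurable_mulmx => // {i}i {j}j; apply: measurable_invmx.
  by move=> x; apply: ridge_unitmx; rewrite invr_gt0.
move=> i' j'; under eq_fun do rewrite mxE.
by apply: measurable_funD => //; exact: measurable_mulmx.
Qed.

End measurable_ops.
End MatrixMeasurability.

(** * Conditional expectation given [X], and its computation under independence *)

Section ConditionalExpectation.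
Local Open Scope ereal_scope.
Context d (T : measurableType d) (R : realType) (P : probability T R).
Context d1 (U : measurableType d1) (X : {mfun T >-> U}).

Lemma g_sigma_algebra_preimage_measurable (A : set T) :
  g_sigma_algebra_preimage X A -> measurable A.
Proof. by move=> [B mB <-]; exact: measurable_funPT. Qed.

Lemma measurable_fun_g_sigma_algebra_preimage (Z : T -> \bar R) :
  measurable_fun setT (Z : g_sigma_algebra_preimageType X -> \bar R) ->
  measurable_fun setT Z.
Proof.
by move=> mZ _ B mB; apply: g_sigma_algebra_preimage_measurable; exact: mZ.
Qed.

(** This needs nothing of [Y]: either a version was selected, or the value is the constant
    default. *)
Lemma measurable_cexp_ge0 (Y : T -> \bar R) :
  measurable_fun setT (cexp_ge0 P X Y).
Proof.
rewrite /cexp_ge0; case: xgetP => [Z _ [_ mZ _]|_].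
  exact: measurable_fun_g_sigma_algebra_preimage.
exact: measurable_cst.
Qed.

Lemma measurable_cexp (Y : T -> \bar R) : measurable_fun setT (cexp P X Y).
Proof. by apply: emeasurable_funB; exact: measurable_cexp_ge0. Qed.

(** Finiteness of the common integral permits subtraction: [g - f] is positive on [A] with integral
    zero. *)
Lemma ge0_integral_lt_negligible (A : set T) (f g : T -> \bar R) :
  measurable A -> measurable_fun setT f -> measurable_fun setT g ->
  (forall x, 0 <= f x) -> (forall x, A x -> f x < g x) ->
  \int[P]_(x in A) f x < +oo ->
  \int[P]_(x in A) f x = \int[P]_(x in A) g x -> P.-negligible A.
Proof.
move=> mA mf mg f0 fg foo fgE.
have g0 x : A x -> 0 <= g x by move=> Ax; rewrite (le_trans (f0 x))// ltW// fg.
have ffin x : A x -> f x \is a fin_num.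
  by move=> Ax; rewrite ge0_fin_numE// (lt_le_trans (fg _ Ax))// leey.
have mfA : measurable_fun A f by exact: measurable_funTS.
have mgA : measurable_fun A g by exact: measurable_funTS.
have fi : P.-integrable A f.
  apply/integrableP; split => //.
  by under eq_integral do rewrite gee0_abs//.
have gi : P.-integrable A g.
  apply/integrableP; split => //.
  under eq_integral => x /set_mem Ax do rewrite (gee0_abs (g0 _ Ax)).
  by rewrite -fgE.
have : \int[P]_(x in A) `|g x - f x| = 0.
  under eq_integral => x /set_mem Ax.
    rewrite gee0_abs; last by rewrite sube_ge0 ?ltW ?fg// ffin.
    over.
  rewrite integralB// -fgE subee// ge0_fin_numE//.
  by apply: integral_ge0.
move/(ae_eq_integral_abs P mA (emeasurable_funB mgA mfA)).
apply: negligibleS => x Ax /= /(_ Ax) => e.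
have := fg _ Ax; rewrite -sube_gt0 ?ffin//.
by rewrite e ltxx.
Qed.

(** [Y] may have infinite expectation, so the versions are compared on events where [Z'] is bounded;
    these exhaust [T] because [Z'] is finite. *)
Lemma is_cexp_ge0_unique (Y Z Z' : T -> \bar R) :
  is_cexp_ge0 P X Y Z -> is_cexp_ge0 P X Y Z' -> (forall w, Z' w < +oo) ->
  ae_eq P setT Z Z'.
Proof.
move=> [Z0 mZ ZY] [Z'0 mZ' Z'Y] Z'fin.
have mZT := measurable_fun_g_sigma_algebra_preimage mZ.
have mZ'T := measurable_fun_g_sigma_algebra_preimage mZ'.
(* The cut [Z' <= k] keeps the events in the sigma-algebra of [X] and makes the integral of [Z']
   over them finite. *)
pose A (k : nat) := [set w | Z w < Z' w] `&` [set w | Z' w <= k%:R%:E].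
pose B (k : nat) := [set w | Z' w < Z w] `&` [set w | Z' w <= k%:R%:E].
have mC k : g_sigma_algebra_preimage X [set w | Z' w <= k%:R%:E].
  rewrite -[X in g_sigma_algebra_preimage _ X]setTI.
  exact: (emeasurable_fun_infty_c (@measurableT _ (g_sigma_algebra_preimageType X)) mZ').
have mA k : g_sigma_algebra_preimage X (A k).
  apply: (@measurableI _ (g_sigma_algebra_preimageType X)); last exact: mC.
  rewrite -[X in measurable X]setTI.
  exact: (measurable_lte (@measurableT _ (g_sigma_algebra_preimageType X)) mZ mZ').
have mB k : g_sigma_algebra_preimage X (B k).
  apply: (@measurableI _ (g_sigma_algebra_preimageType X)); last exact: mC.
  rewrite -[X in measurable X]setTI.
  exact: (measurable_lte (@measurableT _ (g_sigma_algebra_preimageType X)) mZ' mZ).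
have bnd k (E : set T) : measurable E -> E `<=` [set w | Z' w <= k%:R%:E] ->
    \int[P]_(x in E) Z' x < +oo.
  move=> mE Ek; apply: (@le_lt_trans _ _ (\int[P]_(x in E) (cst k%:R%:E) x)).
    by apply: ge0_le_integral => //; exact: measurable_funTS.
  rewrite integral_cst// lte_mul_pinfty ?lee_fin//.
  by rewrite (le_lt_trans (probability_le1 _ _))// ltry.
have nA k : P.-negligible (A k).
  have mAk := g_sigma_algebra_preimage_measurable (mA k).
  apply: (ge0_integral_lt_negligible mAk mZT mZ'T Z0); [by move=> x []| |].
    by rewrite ZY// -Z'Y//; apply: (bnd k) => // x [].
  by rewrite ZY// Z'Y.
have nB k : P.-negligible (B k).
  have mBk := g_sigma_algebra_preimage_measurable (mB k).
  apply: (ge0_integral_lt_negligible mBk mZ'T mZT Z'0); [by move=> x []| |].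
    by apply: (bnd k) => // x [].
  by rewrite ZY// Z'Y.
have nAB := negligibleU (negligible_bigcup nA) (negligible_bigcup nB).
apply: negligibleS nAB => w /= /not_implyP[_ /eqP ZZ'].
have [k Z'k] : exists k, Z' w <= k%:R%:E.
  exists (Num.truncn (fine (Z' w))).+1.
  rewrite -(@fineK _ (Z' w)) ?ge0_fin_numE// lee_fin ltW// Num.Theory.truncnS_gt//.
move: ZZ'; rewrite neq_lt => /orP[lt|lt]; [left|right]; exists k => //.
Qed.

Lemma ae_eq_is_cexp_ge0 (Y Y' Z : T -> \bar R) :
  measurable_fun setT Y -> measurable_fun setT Y' ->
  (forall w, 0 <= Y w) -> (forall w, 0 <= Y' w) -> ae_eq P setT Y Y' ->
  is_cexp_ge0 P X Y Z -> is_cexp_ge0 P X Y' Z.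
Proof.
move=> mY mY' Y0 Y'0 YY' [Z0 mZ ZY]; split => // A mA; rewrite ZY//.
have mAT := g_sigma_algebra_preimage_measurable mA.
apply: ge0_ae_eq_integral => //; try exact: measurable_funTS.
by apply: ae_eq_subset YY'.
Qed.

(** [Z] itself witnesses existence, so [cexp_ge0] selects a genuine version and uniqueness
    applies. *)
Lemma ae_eq_cexp_ge0 (Y Z : T -> \bar R) :
  is_cexp_ge0 P X Y Z -> (forall w, Z w < +oo) ->
  ae_eq P setT (cexp_ge0 P X Y) Z.
Proof.
move=> YZ Zfin; apply: (is_cexp_ge0_unique _ YZ Zfin).
exact: (xgetPex (cst 0) (ex_intro _ Z YZ)).
Qed.

Section independence.
Context d2 (V : measurableType d2) (E : {mfun T >-> V}).
Hypothesis XE : indep_RV P X E.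

(** Independence says that the joint law agrees with the product law on rectangles, hence
    everywhere; Tonelli then splits the integral. *)
Lemma ge0_integral_indep (f : U * V -> \bar R) :
  measurable_fun setT f -> (forall z, 0 <= f z) ->
  \int[P]_w f (X w, E w) = \int[P]_w \int[P]_w' f (X w, E w').
Proof.
move=> mf f0.
pose XEw w := (X w, E w).
have mXE : measurable_fun setT XEw by exact: measurable_fun_pair.
pose XEm : {mfun T >-> (U * V)%type} := HB.pack XEw (isMeasurableFun.Build _ _ _ _ XEw mXE).
have -> : \int[P]_w f (X w, E w) = \int[distribution P XEm]_z f z.
  by rewrite ge0_integral_distribution.
have -> : \int[distribution P XEm]_z f z =
    \int[distribution P X \x distribution P E]_z f z.
  apply: eq_measure_integral => A mA _; apply/esym.
  by apply: product_measure_unique.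
rewrite fubini_tonelli1// ge0_integral_distribution//; last 2 first.
  exact: measurable_fun_fubini_tonelli_F.
  by move=> u; apply: integral_ge0.
apply: eq_integral => w _ /=; rewrite /fubini_F ge0_integral_distribution//.
exact: measurableT_comp.
Qed.

(** The freezing lemma: given [X], integrate over [E] alone with [X] held fixed. *)
Lemma is_cexp_ge0_indep (f : U * V -> \bar R) :
  measurable_fun setT f -> (forall z, 0 <= f z) ->
  is_cexp_ge0 P X (fun w => f (X w, E w)) (fun w => \int[P]_w' f (X w, E w')).
Proof.
move=> mf f0; split.
- by move=> w; apply: integral_ge0.
- have mF := @measurable_fun_fubini_tonelli_F _ _ U V R (distribution P E) f mf f0.
  move=> _ B mB; rewrite setTI.
  (* The candidate factors through [X] as a partial integral against the law of [E], whence its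
     measurability. *)
  exists (fubini_F (distribution P E) f @^-1` B).
    by rewrite -[X in measurable X]setTI; exact: mF.
  rewrite setTI; apply/seteqP; split => w /=;
    rewrite /fubini_F ge0_integral_distribution//; exact: measurableT_comp.
- move=> _ [B mB <-]; rewrite setTI.
  (* Restricting [f] absorbs the event that [X] lies in [B] into the integrand, so that
     [ge0_integral_indep] applies. *)
  pose g := f \_ (B `*` setT).
  have mBT : measurable (B `*` [set: V]) by exact: measurableX.
  have mg : measurable_fun setT g.
    exact: (measurable_restrictT f mBT).1 (measurable_funTS mf).
  have g0 z : 0 <= g z by rewrite /g patchE; case: ifPn.
  rewrite integral_mkcond [RHS]integral_mkcond.
  have := ge0_integral_indep mg g0.
  rewrite [X in X = _ -> _](_ : _ =
    \int[P]_w ((fun w => f (X w, E w)) \_ (X @^-1` B)) w); last first.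
    apply: eq_integral => w _; rewrite /g !patchE.
    congr (if _ then _ else _); apply/idP/idP; rewrite !inE/=; tauto.
  move=> ->; apply: eq_integral => w _; rewrite patchE.
  case: ifPn => wB.
    apply: eq_integral => w' _; rewrite /g patchE ifT//.
    by rewrite inE/=; split => //; exact: set_mem wB.
  rewrite integral0_eq// => w' _; rewrite /g patchE ifF//.
  by apply/negbTE; apply: contra wB; rewrite !inE/= => -[].
Qed.

(** Integrability is asked only for each frozen value [u], since [g (X, E)] itself may fail to be
    integrable. [W] is kept apart from [g (X, E)] because the centred estimator has the required
    form only almost surely. *)
Lemma cexp_indep (g : U * V -> R) (W : T -> R) :
  measurable_fun setT g -> measurable_fun setT W ->
  ae_eq P setT W (fun w => g (X w, E w)) ->
  (forall u, P.-integrable setT (fun w => (g (u, E w))%:E)) ->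
  ae_eq P setT (cexp P X (fun w => (W w)%:E))
    (fun w => \int[P]_w' (g (X w, E w'))%:E).
Proof.
move=> mg mW Wg gi.
have mEg : measurable_fun setT (EFin \o g) by exact/measurable_EFinP.
have mXE : measurable_fun setT (fun w => (X w, E w)).
  exact: measurable_fun_pair.
have mEW : measurable_fun setT (fun w => (W w)%:E) by exact/measurable_EFinP.
have EWg : ae_eq P setT (fun w => (W w)%:E) (fun w => (g (X w, E w))%:E).
  exact: ae_eq_comp Wg.
have /ae_eq_funeposneg[Wp Wn] := EWg.
have Hp : ae_eq P setT (cexp_ge0 P X (fun w => (W w)%:E)^\+)
    (fun w => \int[P]_w' (EFin \o g)^\+ (X w, E w')).
  apply: ae_eq_cexp_ge0; last first.
    move=> w.
    rewrite (_ : (fun w' => _) = (fun w' => (g (X w, E w'))%:E)^\+); last first.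
      by apply/funext => w'; rewrite !funeposE.
    have /integrable_funepos := gi (X w).
    move=> /(_ measurableT)/integrableP[_].
    by under eq_integral do rewrite gee0_abs//.
  apply: (ae_eq_is_cexp_ge0 (Y := fun w => (EFin \o g)^\+ (X w, E w))) => //.
  - exact: (measurableT_comp (measurable_funepos mEg) mXE).
  - exact: measurable_funepos.
  - by apply: filterS Wp => w + _ => /(_ I); rewrite !funeposE => ->.
  - by apply: is_cexp_ge0_indep => //; exact: measurable_funepos.
have Hn : ae_eq P setT (cexp_ge0 P X (fun w => (W w)%:E)^\-)
    (fun w => \int[P]_w' (EFin \o g)^\- (X w, E w')).
  apply: ae_eq_cexp_ge0; last first.
    move=> w.
    rewrite (_ : (fun w' => _) = (fun w' => (g (X w, E w'))%:E)^\-); last first.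
      by apply/funext => w'; rewrite !funenegE.
    have /integrable_funeneg := gi (X w).
    move=> /(_ measurableT)/integrableP[_].
    by under eq_integral do rewrite gee0_abs//.
  apply: (ae_eq_is_cexp_ge0 (Y := fun w => (EFin \o g)^\- (X w, E w))) => //.
  - exact: (measurableT_comp (measurable_funeneg mEg) mXE).
  - exact: measurable_funeneg.
  - by apply: filterS Wn => w + _ => /(_ I); rewrite !funenegE => ->.
  - by apply: is_cexp_ge0_indep => //; exact: measurable_funeneg.
apply: filterS2 Hp Hn => w /(_ I) hp /(_ I) hn _.
rewrite /cexp [RHS]integralE.
rewrite hp hn; congr (_ - _); apply: eq_integral => w' _.
  by rewrite !funeposE.
by rewrite !funenegE.
Qed.

End independence.
End ConditionalExpectation.

(** * Linearity of the matrix expectation under two-sided multiplication *)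

Section MatrixExpectation.
Context d (T : measurableType d) (R : realType) (P : probability T R).

Lemma mulmx_sum_pair m n p q (A : 'M[R]_(p, m)) (Z : 'M[R]_(m, n)) (B : 'M[R]_(n, q)) i j :
  (A *m Z *m B) i j = \sum_(kl : 'I_m * 'I_n) A i kl.1 * B kl.2 j * Z kl.1 kl.2.
Proof.
rewrite mxE; under eq_bigr do rewrite mxE big_distrl/=.
rewrite -(pair_big xpredT xpredT (fun k l => A i k * B l j * Z k l))/= exchange_big/=.
by apply: eq_bigr => k _; apply: eq_bigr => l _; rewrite mulrAC.
Qed.

Section bilinear.
Variables (m n p q : nat) (Z : T -> 'M[R]_(m, n)).
Hypothesis Zi : mx_integrable P Z.
Variables (A : 'M[R]_(p, m)) (B : 'M[R]_(n, q)).

Lemma mx_integrable_mulmx : mx_integrable P (fun w => A *m Z w *m B).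
Proof.
move=> i j; under eq_fun do rewrite mulmx_sum_pair -sumEFin.
apply: integrable_sum => // kl _; under eq_fun do rewrite EFinM.
exact: integrableZl.
Qed.

Lemma integral_mulmx i j : (\int[P]_w ((A *m Z w *m B) i j)%:E =
  ((A *m mx_expectation P Z *m B) i j)%:E)%E.
Proof.
under eq_integral do rewrite mulmx_sum_pair -sumEFin.
rewrite mulmx_sum_pair -sumEFin integral_sum//; last first.
  by move=> kl; under eq_fun do rewrite EFinM; exact: integrableZl.
apply: eq_bigr => kl _; under eq_integral do rewrite EFinM.
rewrite integralZl// [RHS]EFinM mxE expectation.unlock fineK//.
exact: integrable_fin_num.
Qed.

End bilinear.
End MatrixExpectation.

(** * Nonnegativity from positive definiteness *)

Section PositiveForms.
Variable R : realType.

Lemma posdefmx_ge0 n (A : 'M[R]_n) (v : 'cV[R]_n) :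
  posdefmx A -> 0 <= (v^T *m A *m v) 0 0.
Proof.
move=> [_ A0]; have [->|/A0/ltW//] := eqVneq v 0.
by rewrite mulmx0 mxE.
Qed.

Lemma posdefmx_diag_ge0 n (A : 'M[R]_n) i : posdefmx A -> 0 <= A i i.
Proof.
move=> /(posdefmx_ge0 (delta_mx i 0)).
by rewrite trmx_delta -rowE -colE !mxE.
Qed.

End PositiveForms.

(** * Averaging over sign and permutation matrices by sphericity *)

Section SphericalVariance.
Context d (T : measurableType d) (R : realType) (P : probability T R).
Variables (n p : nat) (X : {RV P >-> 'M[R]_(n, p)}).

(** Both sides are integrals of [f] against a law, and sphericity equates the laws of [O X] and
    [X]. *)
Lemma left_spherical_integral (O : 'M[R]_n) (f : 'M[R]_(n, p) -> \bar R) :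
  left_spherical P X -> O *m O^T = 1%:M -> O^T *m O = 1%:M ->
  measurable_fun setT f -> (forall M, 0 <= f M)%E ->
  (\int[P]_w f (O *m X w) = \int[P]_w f (X w))%E.
Proof.
move=> sX OO OO' mf f0.
have mOX : measurable_fun setT (fun w => O *m X w).
  have mO := mx_continuous_measurable (@mulmx_continuous R n p n O).
  by apply: (measurableT_comp mO).
pose OX : {mfun T >-> 'M[R]_(n, p)} :=
  HB.pack (fun w => O *m X w) (isMeasurableFun.Build _ _ _ _ _ mOX).
transitivity (\int[distribution P OX]_M f M)%E.
  by rewrite ge0_integral_distribution.
rewrite -[RHS](ge0_integral_distribution X mf f0).
by apply: eq_measure_integral => B mB _; exact: sX.
Qed.

Variables Sigma : 'M[R]_p.
Hypothesis Sigma_posdef : posdefmx Sigma.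

Definition pinv_form (M : 'M[R]_(n, p)) : 'M[R]_n :=
  (mpinv M)^T *m Sigma *m mpinv M.

Lemma pinv_form_ge0 M (v : 'cV[R]_n) : 0 <= (v^T *m pinv_form M *m v) 0 0.
Proof.
rewrite /pinv_form !mulmxA -trmx_mul -(mulmxA _ _ v).
exact: posdefmx_ge0.
Qed.

Lemma pinv_form_diag_ge0 M i : 0 <= pinv_form M i i.
Proof.
have := pinv_form_ge0 M (delta_mx i 0).
by rewrite trmx_delta -rowE -colE !mxE.
Qed.

Lemma pinv_form_orthogonal (O : 'M[R]_n) M : O^T *m O = 1%:M ->
  pinv_form (O *m M) = O *m pinv_form M *m O^T.
Proof.
by move=> OO; rewrite /pinv_form mpinv_orthogonal// trmx_mul trmxK !mulmxA.
Qed.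

Lemma measurable_pinv_form i j : measurable_fun setT (fun M => pinv_form M i j).
Proof.
have mp k l : measurable_fun setT (fun M : 'M[R]_(n, p) => mpinv M k l).
  by apply: measurable_mpinv => {}k {}l; exact: measurable_coord.
apply: measurable_mulmx => // {i j} i j; apply: measurable_mulmx => // k l.
by under eq_fun do rewrite mxE; exact: mp.
Qed.

(** Conjugating by the transposition of [i] and [j] exchanges the two diagonal entries. *)
Lemma integral_pinv_form_diag i j : left_spherical P X ->
  (\int[P]_w (pinv_form (X w) i i)%:E = \int[P]_w (pinv_form (X w) j j)%:E)%E.
Proof.
move=> sX; pose O : 'M[R]_n := perm_mx (tperm i j).
have OT : O^T = perm_mx (tperm i j)^-1 by exact: tr_perm_mx.
have OO : O *m O^T = 1%:M by rewrite OT -perm_mxM mulgV perm_mx1.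
have OO' : O^T *m O = 1%:M by rewrite OT -perm_mxM mulVg perm_mx1.
rewrite -(left_spherical_integral (f := fun M => (pinv_form M i i)%:E) sX OO OO'); first last.
- by move=> M; rewrite lee_fin pinv_form_diag_ge0.
- by apply/measurable_EFinP; exact: measurable_pinv_form.
apply: eq_integral => w _; rewrite pinv_form_orthogonal// OT -col_permE -row_permE.
by rewrite !mxE tpermL.
Qed.

Definition sign_mx (s : {ffun 'I_n -> bool}) : 'M[R]_n :=
  diag_mx (\row_i (-1) ^+ s i).

Lemma sign_mxT s : (sign_mx s)^T = sign_mx s.
Proof. exact: tr_diag_mx. Qed.

Lemma sign_mxK s : sign_mx s *m sign_mx s = 1%:M.
Proof.
apply/matrixP => i j; rewrite mul_diag_mx !mxE.
by rewrite mulrnAr -expr2 sqrr_sign.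
Qed.

(** The coefficient of [A i j * B j i] is the sum over [s] of the product of the signs at [i] and
    [j]: it vanishes off the diagonal and counts all [s] on it. *)
Lemma sum_sign_conj (A B : 'M[R]_n) :
  \sum_s \tr (A *m (sign_mx s *m B *m (sign_mx s)^T)) =
  #|{ffun 'I_n -> bool}|%:R * \sum_i A i i * B i i.
Proof.
have E s : \tr (A *m (sign_mx s *m B *m (sign_mx s)^T)) =
    \sum_i \sum_j (-1) ^+ s i * (-1) ^+ s j * (A i j * B j i).
  apply: eq_bigr => i _; rewrite mxE; apply: eq_bigr => j _.
  rewrite sign_mxT mul_mx_diag mul_diag_mx !mxE; ring.
under eq_bigr do rewrite E.
rewrite exchange_big/= mulr_sumr; apply: eq_bigr => i _.
rewrite exchange_big/= (bigD1 i)//= [X in _ + X]big1 ?addr0.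
  under eq_bigr do rewrite -expr2 sqrr_sign mul1r.
  by rewrite sumr_const mulr_natl.
move=> j ji; rewrite -mulr_suml.
(* flipping the sign at i is an involution which negates the summand *)
pose flip (s : {ffun 'I_n -> bool}) : {ffun 'I_n -> bool} :=
  [ffun k => if k == i then ~~ s k else s k].
have flipK : involutive flip.
  by move=> s; apply/ffunP => k; rewrite !ffunE; case: eqP => // _; rewrite negbK.
set S := \sum_s _; suff SS : S = - S.
  by clearbody S; rewrite (_ : S = 0) ?mul0r//; lra.
rewrite {1}/S (reindex_inj (inv_inj flipK))/= -sumrN.
apply: eq_bigr => s _; rewrite !ffunE eqxx (negbTE ji).
by case: (s i); rewrite ?expr0 ?expr1 ?mulN1r ?mul1r ?opprK.
Qed.

Variable Omega : 'M[R]_n.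
Hypothesis Omega_posdef : posdefmx Omega.
Hypothesis tr_Omega_form_ge0 : forall M, 0 <= \tr (Omega *m pinv_form M).

(** With [q] the common integral of the diagonal entries, both sides reduce to [tr Omega * q].
    [tr_Omega_form_ge0] lets sum and integral be exchanged without integrability. *)
Lemma integral_tr_pinv_form : (0 < n)%N -> left_spherical P X ->
  (\int[P]_w (\tr (Omega *m pinv_form (X w)))%:E =
   (n%:R^-1 * \tr Omega)%:E * \int[P]_w (\tr (pinv_form (X w)))%:E)%E.
Proof.
move=> n0 sX; pose i0 := Ordinal n0.
set q := (\int[P]_w (pinv_form (X w) i0 i0)%:E)%E.
have mQ i j : measurable_fun setT (fun w => (pinv_form (X w) i j)%:E).
  apply/measurable_EFinP; apply: (measurableT_comp (measurable_pinv_form i j)).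
  exact: measurable_funP.
have trQ : (\int[P]_w (\tr (pinv_form (X w)))%:E = n%:R%:E * q)%E.
  under eq_integral do rewrite -sumEFin.
  rewrite ge0_integral_sum//; last by move=> i w _; rewrite lee_fin pinv_form_diag_ge0.
  rewrite (eq_bigr (fun=> q)); last by move=> i _; exact: integral_pinv_form_diag.
  by rewrite big_const card_ord mule_natl iter_addr_0.
have diagQ : (\int[P]_w (\sum_i Omega i i * pinv_form (X w) i i)%:E = (\tr Omega)%:E * q)%E.
  under eq_integral do rewrite -sumEFin.
  rewrite ge0_integral_sum//; first last.
  - by move=> i w _; rewrite lee_fin mulr_ge0// ?pinv_form_diag_ge0// posdefmx_diag_ge0.
  - by move=> i; under eq_fun do rewrite EFinM; exact: emeasurable_funM.
  (* As [q] may be [+oo], distributivity rests on the diagonal entries of [Omega] being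
     nonnegative. *)
  rewrite /mxtrace -sumEFin ge0_sume_distrl; last by move=> i _; rewrite lee_fin posdefmx_diag_ge0.
  apply: eq_bigr => i _; under eq_integral do rewrite EFinM.
  rewrite ge0_integralZl// ?lee_fin ?posdefmx_diag_ge0//.
  - by rewrite (integral_pinv_form_diag i i0).
  - by move=> w _; rewrite lee_fin pinv_form_diag_ge0.
have mtr : measurable_fun setT (fun M => (\tr (Omega *m pinv_form M))%:E).
  apply/measurable_EFinP; apply: measurable_sum => i.
  by apply: measurable_mulmx => // k l; exact: measurable_pinv_form.
have avg s : (\int[P]_w (\tr (Omega *m pinv_form (sign_mx s *m X w)))%:E =
    \int[P]_w (\tr (Omega *m pinv_form (X w)))%:E)%E.
  apply: (left_spherical_integral (f := fun M => (\tr (Omega *m pinv_form M))%:E) sX).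
  - by rewrite sign_mxT sign_mxK.
  - by rewrite sign_mxT sign_mxK.
  - exact: mtr.
  - by move=> M; rewrite lee_fin.
set N : R := #|{ffun 'I_n -> bool}|%:R.
have N0 : 0 < N by rewrite ltr0n card_ffun card_bool expn_gt0.
have : (N%:E * \int[P]_w (\tr (Omega *m pinv_form (X w)))%:E = N%:E * ((\tr Omega)%:E * q))%E.
  transitivity (\sum_(s : {ffun 'I_n -> bool})
      \int[P]_w (\tr (Omega *m pinv_form (sign_mx s *m X w)))%:E)%E.
    rewrite (eq_bigr _ (fun s _ => avg s)) big_const.
    by rewrite mule_natl iter_addr_0.
  rewrite -ge0_integral_sum//; first last.
  - by move=> s w _; rewrite lee_fin.
  - move=> s; apply: (measurableT_comp mtr).
    have mO := mx_continuous_measurable (@mulmx_continuous R n p n (sign_mx s)).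
    by apply: (measurableT_comp mO).
  rewrite -diagQ -ge0_integralZl//; first last.
  - by rewrite lee_fin ltW.
  - move=> w _; rewrite lee_fin sumr_ge0// => i _.
    by rewrite mulr_ge0// ?pinv_form_diag_ge0// posdefmx_diag_ge0.
  - under eq_fun do rewrite -sumEFin.
    by apply: emeasurable_sum => i; under eq_fun do rewrite EFinM; exact: emeasurable_funM.
  apply: eq_integral => w _; rewrite sumEFin -EFinM; congr _%:E.
  rewrite -sum_sign_conj; apply: eq_bigr => s _.
  by rewrite pinv_form_orthogonal// sign_mxT sign_mxK.
(* [N] is positive and finite, so it cancels even against an infinite [x]. *)
have NK x : (N^-1%:E * (N%:E * x) = x)%E.
  by rewrite muleA -EFinM mulVf ?mul1e// gt_eqF.
move=> /(congr1 (mule N^-1%:E)); rewrite !NK => ->.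
by rewrite trQ muleA -EFinM mulrAC mulVf ?mul1r// pnatr_eq0 -lt0n.
Qed.

End SphericalVariance.

(** * Conditional mean and covariance of the least squares estimator *)

Section LeastSquares.
Context d (T : measurableType d) (R : realType) (P : probability T R).
Variables (n p : nat) (X : {RV P >-> 'M[R]_(n, p)}) (eps : {RV P >-> 'cV[R]_n}).
Hypothesis X_eps_indep : indep_RV P X eps.
Hypothesis eps_integrable : mx_integrable P eps.
Hypothesis eps_mean0 : mx_expectation P eps = 0.
Hypothesis eps2_integrable : mx_integrable P (fun w => eps w *m (eps w)^T).

Let Omega := mx_expectation P (fun w => eps w *m (eps w)^T).

Variables (beta : 'cV[R]_p) (betahat : T -> 'cV[R]_p).
Hypothesis betahatE : betahat = fun w => mpinv (X w) *m (X w *m beta + eps w).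

Let measurable_RV_coord m q (Z : {RV P >-> 'M[R]_(m, q)}) i j :
  measurable_fun setT (fun w => Z w i j).
Proof. exact: (measurableT_comp (measurable_coord i j) (measurable_funP Z)). Qed.

Let mX := measurable_RV_coord X.
Let meps := measurable_RV_coord eps.

Let measurable_fst_coord i j : measurable_fun setT
  (fun z : 'M[R]_(n, p) * 'cV[R]_n => z.1 i j).
Proof. exact: (measurableT_comp (measurable_coord i j) measurable_fst). Qed.

Let measurable_snd_coord i j : measurable_fun setT
  (fun z : 'M[R]_(n, p) * 'cV[R]_n => z.2 i j).
Proof. exact: (measurableT_comp (measurable_coord i j) measurable_snd). Qed.

Lemma measurable_betahat i j : measurable_fun setT (fun w => betahat w i j).
Proof.
rewrite betahatE; apply: measurable_mulmx => {i j} i j.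
  by apply: measurable_mpinv; exact: mX.
under eq_fun do rewrite mxE; apply: measurable_funD; last exact: meps.
by apply: measurable_mulmx => //; exact: mX.
Qed.

(** For frozen [X = M] the estimator is [M^+ M beta + M^+ eps], and the noise term integrates to
    zero. *)
Lemma mx_cexp_betahat :
  \forall w \ae P, mx_cexp P X betahat w = mpinv (X w) *m X w *m beta.
Proof.
suff : \forall w \ae P, forall i j,
    cexp P X (fun w' => (betahat w' i j)%:E) w = ((mpinv (X w) *m X w *m beta) i j)%:E.
  by apply: filterS => w H; apply/matrixP => i j; rewrite mxE H.
apply: filter_forall => i; apply: filter_forall => j.
pose g (z : 'M[R]_(n, p) * 'cV[R]_n) := (mpinv z.1 *m (z.1 *m beta + z.2)) i j.
have mg : measurable_fun setT g.
  apply: measurable_mulmx => k l; first by apply: measurable_mpinv.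
  under eq_fun do rewrite mxE; apply: measurable_funD => //.
  exact: measurable_mulmx.
(* The trailing identity matrix gives the noise term the two-sided shape of [integral_mulmx]. *)
have gE M e : (g (M, e))%:E =
    (((mpinv M *m M *m beta) i j)%:E + ((mpinv M *m e *m 1%:M) i j)%:E)%E.
  by rewrite /g mulmx1 mulmxDr mulmxA mxE EFinD.
have ci (c : R) : P.-integrable setT (fun=> c%:E) by exact: finite_measure_integrable_cst.
have ei M := mx_integrable_mulmx eps_integrable (mpinv M) 1%:M i j.
have gi M : P.-integrable setT (fun w => (g (M, eps w))%:E).
  by under eq_fun do rewrite gE; exact: integrableD.
have Wg : ae_eq P setT (fun w => betahat w i j) (fun w => g (X w, eps w)).
  by apply: nearW => w _; rewrite betahatE.
apply: filterS (cexp_indep X_eps_indep mg (measurable_betahat i j) Wg gi).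
move=> w /(_ I) ->.
under eq_integral do rewrite gE.
rewrite integralD// integral_cst//.
rewrite [X in (_ * X + _)%E](_ : _ = 1%E) ?mule1; last exact: probability_setT.
by rewrite integral_mulmx// eps_mean0 mulmx0 mul0mx [X in (_ + X%:E)%E]mxE adde0.
Qed.

Lemma measurable_mx_cexp m q (Z : T -> 'M[R]_(m, q)) i j :
  measurable_fun setT (fun w => mx_cexp P X Z w i j).
Proof.
under eq_fun do rewrite mxE.
exact: (measurableT_comp (fine_measurable measurableT) (measurable_cexp _ _ _)).
Qed.

(** The centred estimator is almost surely [X^+ eps]; freezing [X] in its outer product turns
    [eps eps^T] into [Omega]. *)
Lemma ccov_betahat : \forall w \ae P,
  ccov P X betahat w = mpinv (X w) *m Omega *m (mpinv (X w))^T.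
Proof.
suff : \forall w \ae P, forall i j, cexp P X (fun w' =>
    (((betahat w' - mx_cexp P X betahat w') *m
      (betahat w' - mx_cexp P X betahat w')^T) i j)%:E) w =
    ((mpinv (X w) *m Omega *m (mpinv (X w))^T) i j)%:E.
  by apply: filterS => w H; apply/matrixP => i j; rewrite mxE H.
apply: filter_forall => i; apply: filter_forall => j.
pose g (z : 'M[R]_(n, p) * 'cV[R]_n) :=
  (mpinv z.1 *m (z.2 *m z.2^T) *m (mpinv z.1)^T) i j.
have mg : measurable_fun setT g.
  apply: measurable_mulmx => k l; last first.
    by under eq_fun do rewrite mxE; exact: measurable_mpinv.
  apply: measurable_mulmx => {}k {}l; first exact: measurable_mpinv.
  apply: measurable_mulmx => // {}k {}l; under eq_fun do rewrite mxE.
  exact: measurable_snd_coord.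
have mD k l : measurable_fun setT (fun w => (betahat w - mx_cexp P X betahat w) k l).
  under eq_fun do rewrite mxE [X in _ + X]mxE.
  by apply: measurable_funB; [exact: measurable_betahat|exact: measurable_mx_cexp].
have mW : measurable_fun setT (fun w => ((betahat w - mx_cexp P X betahat w) *m
      (betahat w - mx_cexp P X betahat w)^T) i j).
  by apply: measurable_mulmx => // k l; under eq_fun do rewrite mxE; exact: mD.
have gi M : P.-integrable setT (fun w => (g (M, eps w))%:E).
  exact: (mx_integrable_mulmx eps2_integrable (mpinv M) (mpinv M)^T i j).
have Wg : ae_eq P setT (fun w => ((betahat w - mx_cexp P X betahat w) *m
    (betahat w - mx_cexp P X betahat w)^T) i j) (fun w => g (X w, eps w)).
  apply: filterS mx_cexp_betahat => w -> _.
  rewrite betahatE mulmxDr mulmxA addrAC subrr add0r.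
  by rewrite /g /= trmx_mul !mulmxA.
apply: filterS (cexp_indep X_eps_indep mg mW Wg gi) => w /(_ I) ->.
exact: (integral_mulmx eps2_integrable (mpinv (X w)) (mpinv (X w))^T i j).
Qed.

Lemma expectation_cvar_betahat (Sigma : 'M[R]_p) :
  ('E_P[cvar P X Sigma betahat] =
   \int[P]_w (\tr (Omega *m pinv_form Sigma (X w)))%:E)%E.
Proof.
rewrite expectation.unlock; apply: ae_eq_integral => //.
- apply/measurable_EFinP; apply: measurable_sum => i.
  by apply: measurable_mulmx => // k l; exact: measurable_mx_cexp.
- apply/measurable_EFinP; apply: measurable_sum => i.
  apply: measurable_mulmx => // k l.
  exact: (measurableT_comp (measurable_pinv_form Sigma k l) (measurable_funP X)).
- apply: filterS ccov_betahat => w e _; congr _%:E.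
  (* Cyclicity of the trace carries [X^+] past [Sigma], forming [Q(X)] next to [Omega]. *)
  rewrite /cvar e /pinv_form mxtrace_mulC !mulmxA mxtrace_mulC !mulmxA.
  by rewrite mxtrace_mulC !mulmxA.
Qed.

(* [tr(Omega Q) = E[eps^T Q eps]]. *)
Lemma tr_Omega_pinv_form_ge0 (Sigma : 'M[R]_p) M : posdefmx Sigma ->
  0 <= \tr (Omega *m pinv_form Sigma M : 'M[R]_n).
Proof.
move=> S0; rewrite -lee_fin.
have -> : ((\tr (Omega *m pinv_form Sigma M))%:E =
    \int[P]_w (\tr ((eps w *m (eps w)^T) *m pinv_form Sigma M))%:E)%E.
  under eq_integral do rewrite -sumEFin.
  rewrite integral_sum//; last first.
    move=> i; under eq_fun do rewrite -[X in (X *m _) i i]mul1mx.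
    exact: mx_integrable_mulmx.
  rewrite -sumEFin; apply: eq_bigr => i _.
  under eq_integral do rewrite -[X in (X *m _) i i]mul1mx.
  by rewrite integral_mulmx// mul1mx.
apply: integral_ge0 => w _; rewrite lee_fin -mulmxA mxtrace_mulC.
by rewrite trace_mx11; exact: pinv_form_ge0.
Qed.

End LeastSquares.

Theorem theorem3p2 (R : realType) (d : measure_display) (T : measurableType d)
  (P : probability T R) (n p : nat) (n_ge1 : (1 <= n)%N) (n_lt_p : (n < p)%N)
  (beta : 'cV[R]_p)
  (X : {RV P >-> 'M[R]_(n, p)}) (eps : {RV P >-> 'cV[R]_n})
  (X_eps_indep : indep_RV P X eps)
  (eps_integrable : mx_integrable P eps)
  (eps_mean0 : mx_expectation P eps = 0)
  (Omega : 'M[R]_n)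
  (Omega_finite : mx_integrable P (fun w => eps w *m (eps w)^T))
  (OmegaE : Omega = mx_expectation P (fun w => eps w *m (eps w)^T))
  (Omega_posdef : posdefmx Omega)
  (y : T -> 'cV[R]_n) (yE : y = fun w => X w *m beta + eps w)
  (X_left_spherical : left_spherical P X)
  (x0 : {RV P >-> 'cV[R]_p})
  (x0_indep : indep_RV P x0 (fun w => (X w, y w)))
  (Sigma : 'M[R]_p)
  (Sigma_finite : mx_integrable P (fun w => x0 w *m (x0 w)^T))
  (SigmaE : Sigma = mx_expectation P (fun w => x0 w *m (x0 w)^T))
  (Sigma_posdef : posdefmx Sigma)
  (betahat : T -> 'cV[R]_p) (betahatE : betahat = fun w => mpinv (X w) *m y w) :
  ('E_P[cvar P X Sigma betahat] =
     (n%:R^-1 * \tr Omega)%R%:E *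
     'E_P[fun w => \tr (mpinv ((X w)^T *m X w) *m Sigma)%R])%E.
Proof.
rewrite yE in betahatE.
rewrite (expectation_cvar_betahat X_eps_indep eps_integrable eps_mean0
  Omega_finite betahatE) -OmegaE.
rewrite (integral_tr_pinv_form Sigma_posdef Omega_posdef)//; last first.
  by move=> M; rewrite OmegaE; exact: tr_Omega_pinv_form_ge0.
congr (_ * _)%E; rewrite expectation.unlock; apply: eq_integral => w _.
(* [(X^T X)^+ = X^+ X^+^T], and one rotation under the trace yields [tr Q(X)]. *)
by rewrite mpinv_gram -mulmxA mxtrace_mulC /pinv_form.
Qed.
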